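(* Let $p\ge 1$ be an integer, let $G\in C^1(\mathbb{D})$ be a complex-valued function (not necessarily harmonic), let $K:\mathbb{D}\to\mathbb{C}$ be harmonic, and let $f(z)=|z|^{2(p-1)}G(z)+K(z)$ for $z\in\mathbb{D}$. Suppose that $f$ is univalent and that $f(\mathbb{D})$ is a linearly connected domain with constant $M$. If $$\frac{2(p-1)|G|+\Lambda_G}{|\lambda_f|}<\frac1M\quad\text{on }\mathbb{D},$$ then $K$ is univalent on $\mathbb{D}$. Moreover, if there is a constant $C$ such that $$\frac{2(p-1)|G|+\Lambda_G}{|\lambda_f|}\le C<\frac1M\quad\text{on }\mathbb{D},$$ then $K(\mathbb{D})$ is a linearly connected domain.
   Context: $\mathbb{D}=\{z\in\mathbb{C}:|z|<1\}$. A complex-valued function is in $C^1(\mathbb{D})$ if its real and imaginary parts have continuous first-order partial derivatives in $\mathbb{D}$. A complex-valued function is harmonic if it is twice continuously differentiable and annihilated by the Laplacian $\Delta=4\frac{\partial^2}{\partial z\,\partial\overline z}$. Univalent means injective. For a $C^1$ function $g$, with Wirtinger derivatives $g_z,g_{\overline z}$, set $\lambda_g=|g_z|-|g_{\overline z}|$ and $\Lambda_g=|g_z|+|g_{\overline z}|$. A domain $\Omega\subset\mathbb{C}$ is linearly connected (with constant $M$) if $M<\infty$ is such that any two points $w_1,w_2\in\Omega$ are joined by a path $\gamma\subset\Omega$ of length $\ell(\gamma)\le M|w_1-w_2|$; it is linearly connected if this holds for some $M<\infty$. Inequalities between functions are understood to hold at every point of $\mathbb{D}$, with the quotients well defined (in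 particular $\lambda_f\ne0$ everywhere). *)

(* Defs.v *)
From Stdlib Require Import Reals.
From Coquelicot Require Import Coquelicot.
Open Scope R_scope.

Definition unit_disk (z : C) : Prop := Cmod z < 1.

Definition ex_partial_x (u : C -> R) (z : C) : Prop :=
  ex_derive (fun t : R => u (t, Im z)) (Re z).
Definition ex_partial_y (u : C -> R) (z : C) : Prop :=
  ex_derive (fun t : R => u (Re z, t)) (Im z).
Definition partial_x (u : C -> R) (z : C) : R :=
  Derive (fun t : R => u (t, Im z)) (Re z).
Definition partial_y (u : C -> R) (z : C) : R :=
  Derive (fun t : R => u (Re z, t)) (Im z).

Definition re_part (g : C -> C) (z : C) : R := Re (g z).
Definition im_part (g : C -> C) (z : C) : R := Im (g z).

(* Functions on a domain D are total functions on C whose values outside D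
   are irrelevant; the predicates and operators below are meant for D open,
   where they depend only on the restriction of the function to D. *)
Definition C1R_on (D : C -> Prop) (u : C -> R) : Prop :=
  forall z : C, D z ->
    ex_partial_x u z /\ ex_partial_y u z /\
    continuous (partial_x u) z /\ continuous (partial_y u) z.

Definition C1_on (D : C -> Prop) (g : C -> C) : Prop :=
  C1R_on D (re_part g) /\ C1R_on D (im_part g).

Definition dx (g : C -> C) (z : C) : C :=
  (partial_x (re_part g) z, partial_x (im_part g) z).
Definition dy (g : C -> C) (z : C) : C :=
  (partial_y (re_part g) z, partial_y (im_part g) z).

Definition C2_on (D : C -> Prop) (g : C -> C) : Prop :=
  C1_on D g /\ C1_on D (dx g) /\ C1_on D (dy g).

Definition dz (g : C -> C) (z : C) : C := ((dx g z - Ci * dy g z) / 2)%C.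
Definition dzbar (g : C -> C) (z : C) : C := ((dx g z + Ci * dy g z) / 2)%C.

Definition laplacian (g : C -> C) (z : C) : C := (4 * dz (dzbar g) z)%C.

Definition harmonic_on (D : C -> Prop) (g : C -> C) : Prop :=
  C2_on D g /\ forall z : C, D z -> laplacian g z = 0%C.

Definition lambda_ (g : C -> C) (z : C) : R := Cmod (dz g z) - Cmod (dzbar g z).
Definition Lambda_ (g : C -> C) (z : C) : R := Cmod (dz g z) + Cmod (dzbar g z).

Definition univalent_on (D : C -> Prop) (g : C -> C) : Prop :=
  forall z1 z2 : C, D z1 -> D z2 -> g z1 = g z2 -> z1 = z2.

Definition image (g : C -> C) (D : C -> Prop) (w : C) : Prop :=
  exists z : C, D z /\ w = g z.

Definition connected_set (W : C -> Prop) : Prop :=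
  forall U V : C -> Prop, open U -> open V ->
    (forall w : C, W w -> U w \/ V w) ->
    (exists w : C, W w /\ U w) -> (exists w : C, W w /\ V w) ->
    exists w : C, W w /\ U w /\ V w.

Definition is_domain (W : C -> Prop) : Prop :=
  (exists w : C, W w) /\ open W /\ connected_set W.

Definition unit_interval (t : R) : Prop := 0 <= t <= 1.

(* [t 0 <= ... <= t (S n)] is a subdivision of [0, 1]; [sum_n] has n + 1 terms.
   These are the lengths of the polygons inscribed in the path. *)
Definition inscribed_length (gamma : R -> C) (l : R) : Prop :=
  exists (n : nat) (t : nat -> R),
    t 0%nat = 0 /\ t (S n) = 1 /\
    (forall i : nat, (i <= n)%nat -> t i <= t (S i)) /\
    l = sum_n (fun i : nat => Cmod (gamma (t (S i)) - gamma (t i))%C) n.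

Definition path_length (gamma : R -> C) : Rbar :=
  Lub_Rbar (inscribed_length gamma).

Definition path_in (W : C -> Prop) (gamma : R -> C) (w1 w2 : C) : Prop :=
  continuous_on unit_interval gamma /\
  gamma 0 = w1 /\ gamma 1 = w2 /\
  forall t : R, unit_interval t -> W (gamma t).

Definition linearly_connected_with (M : R) (W : C -> Prop) : Prop :=
  forall w1 w2 : C, W w1 -> W w2 ->
    exists gamma : R -> C,
      path_in W gamma w1 w2 /\
      Rbar_le (path_length gamma) (M * Cmod (w1 - w2)%C).

Definition linearly_connected (W : C -> Prop) : Prop :=
  exists M : R, linearly_connected_with M W.

(* Main.v *)
Require Import Defs.
From Stdlib Require Import Reals Lra Lia Classical ClassicalEpsilon.
From Coquelicot Require Import Coquelicot.
Open Scope R_scope.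

(* Write H = |z|^(2(p-1)) G, so that f = H + K. The operator norm of the
   derivative of F = H o f^-1 at f z is at most (2(p-1)|G| + Lambda_G) / |lambda_f|,
   hence < 1/M. Integrating along a path of length at most M |w1 - w2| gives
   |F w1 - F w2| < |w1 - w2|, so K o f^-1 = id - F is injective; if the bound is
   uniform, id - F is bi-Lipschitz and carries short paths to short paths.
   Instead of differentiating f^-1, the increments of H and f are compared
   locally (the derivative of f is invertible), and f^-1 is only needed to be
   continuous, which follows from the local surjectivity of f. *)

(** * Euclidean discs and moduli in the plane *)

(** The balls behind [locally] on [C] are squares, being products of intervals; the factor [sqrt 2]
    passes between them and Euclidean discs. *)
Lemma locally_CmodP (P : C -> Prop) (z : C) :
  locally z P <-> exists d, 0 < d /\ forall w, Cmod (w - z)%C < d -> P w.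
Proof.
split.
- intros [d Hd]; exists d; split; [apply cond_pos|].
  intros w Hw; apply Hd, C_NormedModule_mixin_compat1; exact Hw.
- intros [d [d0 Hd]].
  assert (s0 : 0 < sqrt 2) by (apply sqrt_lt_R0; lra).
  exists (mkposreal (d / sqrt 2) (Rdiv_lt_0_compat _ _ d0 s0)).
  intros w Hw; apply Hd.
  apply C_NormedModule_mixin_compat2 in Hw; simpl in Hw.
  replace (sqrt 2 * (d / sqrt 2)) with d in Hw by (field; lra).
  exact Hw.
Qed.

Lemma Cmod_minus_sym (z w : C) : Cmod (z - w) = Cmod (w - z).
Proof. rewrite <- Cmod_opp; f_equal; ring. Qed.

Lemma Cmod_minus_triangle (z w x : C) : Cmod (z - x) <= Cmod (z - w) + Cmod (w - x).
Proof. replace (z - x)%C with ((z - w) + (w - x))%C by ring; apply Cmod_triangle. Qed.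

Lemma Cmod_triangle_inv (z w : C) : Cmod z - Cmod w <= Cmod (z + w).
Proof.
generalize (Cmod_triangle (z + w) (- w)); rewrite Cmod_opp.
replace (z + w + - w)%C with z by ring; lra.
Qed.

Lemma im_le_Cmod (z : C) : Rabs (Im z) <= Cmod z.
Proof. eapply Rle_trans; [|apply Rmax_Cmod]; apply Rmax_r. Qed.

Lemma Cmod_le_Re_Im (z : C) : Cmod z <= Rabs (Re z) + Rabs (Im z).
Proof.
replace z with (RtoC (Re z) + Ci * RtoC (Im z))%C at 1
  by (destruct z; apply injective_projections; simpl; ring).
eapply Rle_trans; [apply Cmod_triangle|].
rewrite Cmod_mult, Cmod_Ci, !Cmod_R; lra.
Qed.

(** * Real-linear maps and strict differentiability *)

(** The general real-linear map of the plane. With [a] and [b] the Wirtinger derivatives of a map it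
    is the differential, whose extreme stretches are $|a|+|b|$ and $||a|-|b||$. *)
Definition rlin (a b h : C) : C := (a * h + b * Cconj h)%C.

(* Differentiability uniform in two moving points; unlike differentiability at
   a point it gives Lipschitz bounds near [z0]. *)
Definition strict_diff (g : C -> C) (z0 a b : C) : Prop :=
  forall eps, 0 < eps -> exists d, 0 < d /\ forall z w,
    Cmod (z - z0) < d -> Cmod (w - z0) < d ->
    Cmod (g z - g w - rlin a b (z - w)) <= eps * Cmod (z - w).

Lemma rlin_upper (a b h : C) : Cmod (rlin a b h) <= (Cmod a + Cmod b) * Cmod h.
Proof.
unfold rlin; eapply Rle_trans; [apply Cmod_triangle|].
rewrite !Cmod_mult, Cmod_conj; lra.
Qed.

(** The reverse triangle inequality is used in both directions, since the sign of [lambda_] is not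
    prescribed: the map may reverse orientation. *)
Lemma rlin_lower (a b h : C) : Rabs (Cmod a - Cmod b) * Cmod h <= Cmod (rlin a b h).
Proof.
unfold rlin.
generalize (Cmod_triangle_inv (a * h) (b * Cconj h)).
generalize (Cmod_triangle_inv (b * Cconj h) (a * h)).
rewrite (Cplus_comm (b * _)%C), !Cmod_mult, Cmod_conj.
unfold Rabs; destruct Rcase_abs; lra.
Qed.

(** Join [w] to [z] by a vertical and then a horizontal segment and apply the mean value theorem on
    each; near [z0] both partial derivatives are within [eps / 2] of their values at [z0]. *)
Lemma C1R_increment (D : C -> Prop) (u : C -> R) (z0 : C) (eps : R) :
  open D -> D z0 -> C1R_on D u -> 0 < eps ->
  exists d, 0 < d /\ forall z w, Cmod (z - z0) < d -> Cmod (w - z0) < d ->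
  Rabs (u z - u w - (partial_x u z0 * (Re z - Re w) + partial_y u z0 * (Im z - Im w)))
    <= eps * Cmod (z - w).
Proof.
intros oD Dz0 Hu e0.
destruct (Hu z0 Dz0) as (_ & _ & cx & cy).
assert (e2 : 0 < eps / 2) by lra.
specialize (cx _ (locally_ball (partial_x u z0) (mkposreal _ e2))).
specialize (cy _ (locally_ball (partial_y u z0) (mkposreal _ e2))).
assert (H : locally z0 (fun z => D z /\
    ball (partial_x u z0) (eps / 2) (partial_x u z) /\
    ball (partial_y u z0) (eps / 2) (partial_y u z))).
{ apply filter_and; [exact (oD z0 Dz0)|]; apply filter_and; [exact cx|exact cy]. }
destruct H as [d Hd]; clear cx cy.
exists d; split; [apply cond_pos|].
(* The neighbourhood is a square, so it also contains the corner of the broken line and both of its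
   segments. *)
assert (box : forall x y, Rabs (x - Re z0) < d -> Rabs (y - Im z0) < d ->
  D (x, y) /\ Rabs (partial_x u (x, y) - partial_x u z0) < eps / 2
  /\ Rabs (partial_y u (x, y) - partial_y u z0) < eps / 2).
{ intros x y Hx Hy; apply Hd; split; [exact Hx|exact Hy]. }
intros z w Hz Hw.
assert (C1 := Rle_lt_trans _ _ _ (re_le_Cmod _) Hz).
assert (C2 := Rle_lt_trans _ _ _ (im_le_Cmod _) Hz).
assert (C3 := Rle_lt_trans _ _ _ (re_le_Cmod _) Hw).
assert (C4 := Rle_lt_trans _ _ _ (im_le_Cmod _) Hw).
assert (C5 := re_le_Cmod (z - w)%C).
assert (C6 := im_le_Cmod (z - w)%C).
destruct z as [x y], w as [x' y'], z0 as [x0 y0]; simpl in *.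
fold (Rminus x x0) in *; fold (Rminus y y0) in *.
fold (Rminus x' x0) in *; fold (Rminus y' y0) in *.
fold (Rminus x x') in *; fold (Rminus y y') in *.
assert (conv : forall s s' x0 t, Rabs (s - x0) < d -> Rabs (s' - x0) < d ->
   Rmin s s' <= t <= Rmax s s' -> Rabs (t - x0) < d).
{ clear; intros s s' x0 t H1 H2 H3.
  apply Rabs_def2 in H1; apply Rabs_def2 in H2; apply Rabs_def1.
  - generalize (Rmax_lub_lt s s' (x0 + d)); intros; lra.
  - generalize (Rmin_glb_lt s s' (x0 - d)); intros; lra. }
destruct (MVT_gen (fun t => u (t, y)) x' x (fun t => partial_x u (t, y))) as [s [Hs Es]].
{ intros t Ht; apply Derive_correct.
  destruct (box t y) as [B _]; auto.
  - apply (conv x' x); auto; lra.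
  - apply (Hu _ B). }
{ intros t Ht; apply continuity_pt_filterlim.
  destruct (box t y) as [B _]; auto.
  - apply (conv x' x); auto; lra.
  - apply (ex_derive_continuous (fun t => u (t, y))); apply (Hu _ B). }
destruct (MVT_gen (fun t => u (x', t)) y' y (fun t => partial_y u (x', t))) as [r [Hr Er]].
{ intros t Ht; apply Derive_correct.
  destruct (box x' t) as [B _]; auto.
  - apply (conv y' y); auto; lra.
  - apply (Hu _ B). }
{ intros t Ht; apply continuity_pt_filterlim.
  destruct (box x' t) as [B _]; auto.
  - apply (conv y' y); auto; lra.
  - apply (ex_derive_continuous (fun t => u (x', t))); apply (Hu _ B). }
destruct (box s y) as (_ & B1 & _); auto.
{ apply (conv x' x); auto. }
destruct (box x' r) as (_ & _ & B2); auto.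
{ apply (conv y' y); auto. }
replace (_ - _ - _) with
  ((partial_x u (s, y) - partial_x u (x0, y0)) * (x - x')
   + (partial_y u (x', r) - partial_y u (x0, y0)) * (y - y')) by lra.
eapply Rle_trans; [apply Rabs_triang|]; rewrite !Rabs_mult.
assert (P1 := Rabs_pos (x - x')); assert (P2 := Rabs_pos (y - y')).
apply Rle_trans with (eps / 2 * Cmod (x - x', y - y') + eps / 2 * Cmod (x - x', y - y')).
- change ((x, y) - (x', y'))%C with (x - x', y - y') in *.
  apply Rplus_le_compat; apply Rmult_le_compat; auto using Rabs_pos; lra.
- change ((x, y) - (x', y'))%C with (x - x', y - y') in *; lra.
Qed.

Lemma C1_strict_diff (D : C -> Prop) (g : C -> C) (z0 : C) :
  open D -> D z0 -> C1_on D g -> strict_diff g z0 (dz g z0) (dzbar g z0).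
Proof.
intros oD Dz0 [H1 H2] eps e0.
destruct (C1R_increment D _ z0 (eps / 2) oD Dz0 H1) as (d1 & d10 & I1); [lra|].
destruct (C1R_increment D _ z0 (eps / 2) oD Dz0 H2) as (d2 & d20 & I2); [lra|].
exists (Rmin d1 d2); split; [apply Rmin_pos; auto|]; intros z w Hz Hw.
assert (M1 := Rmin_l d1 d2); assert (M2 := Rmin_r d1 d2).
specialize (I1 z w ltac:(lra) ltac:(lra)).
specialize (I2 z w ltac:(lra) ltac:(lra)).
eapply Rle_trans; [apply Cmod_le_Re_Im|].
replace (eps * _) with (eps / 2 * Cmod (z - w) + eps / 2 * Cmod (z - w)) by field.
apply Rplus_le_compat; [eapply Rle_trans; [|exact I1]|eapply Rle_trans; [|exact I2]];
  right; f_equal; unfold rlin, dz, dzbar, dx, dy, re_part, im_part;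
  destruct z, w; simpl; unfold Re, Im; field.
Qed.

(** The differential is evaluated on the two coordinate directions: [rlin a b] sends $1$ to $a+b$
    and $i$ to $i(a-b)$. *)
Lemma strict_diff_Derive (g : C -> C) (z0 a b : C) :
  strict_diff g z0 a b ->
  partial_x (re_part g) z0 = Re (a + b) /\ partial_x (im_part g) z0 = Im (a + b) /\
  partial_y (re_part g) z0 = Re (Ci * (a - b)) /\ partial_y (im_part g) z0 = Im (Ci * (a - b)).
Proof.
intros H.
(* One argument for all four partial derivatives: [phi] will be [Re] or [Im], and [path] a
   coordinate line through [z0] with unit direction [v]. *)
assert (key : forall (phi : C -> R) (v : C) (t0 : R) (path : R -> C),
  (forall x, Rabs (phi x) <= Cmod x) ->
  (forall x y, phi (x - y)%C = phi x - phi y) ->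
  (forall (r : R) x, phi (r * x)%C = r * phi x) ->
  Cmod v = 1 -> path t0 = z0 ->
  (forall s t, (path s - path t)%C = ((s - t)%R * v)%C) ->
  Derive (fun t => phi (g (path t))) t0 = phi (rlin a b v)).
{ intros phi v t0 path phi1 phiB phiZ v1 P0 PB.
  apply is_derive_unique; split; [apply (is_linear_scal_l (K:=R_AbsRing))|].
  intros t1 Ht1; rewrite <- (is_filter_lim_locally_unique _ _ Ht1); clear t1 Ht1.
  intros eps; destruct (H eps (cond_pos eps)) as (d & d0 & Hd).
  exists (mkposreal d d0); intros t Ht.
  change (Rabs (t - t0) < d) in Ht.
  change (Rabs (phi (g (path t)) - phi (g (path t0)) - (t - t0) * phi (rlin a b v))
           <= eps * Rabs (t - t0)).
  assert (E : Cmod (path t - path t0) = Rabs (t - t0)).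
  { rewrite PB, Cmod_mult, v1, Cmod_R; ring. }
  rewrite <- E, <- phiZ, <- !phiB.
  replace (RtoC (t - t0) * rlin a b v)%C with (rlin a b (path t - path t0)).
  { eapply Rle_trans; [apply phi1|]; apply Hd; rewrite <- P0, ?E; auto.
    replace (path t0 - path t0)%C with (RtoC 0) by ring.
    rewrite Cmod_0; auto. }
  rewrite PB; unfold rlin; destruct a, b, v; apply injective_projections; simpl; ring. }
assert (P1 : forall s t y, ((s, y) - (t, y))%C = (RtoC (s - t) * 1)%C).
{ intros; apply injective_projections; simpl; ring. }
assert (P2 : forall s t x, ((x, s) - (x, t))%C = (RtoC (s - t) * Ci)%C).
{ intros; apply injective_projections; simpl; ring. }
assert (E0 : (Re z0, Im z0) = z0) by (destruct z0; auto).
unfold partial_x, partial_y, re_part, im_part; repeat split.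
- rewrite (key Re 1%C (Re z0) (fun t => (t, Im z0))); auto using re_le_Cmod, Cmod_1.
  + unfold rlin; destruct a, b; simpl; ring.
  + intros; destruct x; simpl; ring.
- rewrite (key Im 1%C (Re z0) (fun t => (t, Im z0))); auto using im_le_Cmod, Cmod_1.
  + unfold rlin; destruct a, b; simpl; ring.
  + intros; destruct x; simpl; ring.
- rewrite (key Re Ci (Im z0) (fun t => (Re z0, t))); auto using re_le_Cmod, Cmod_Ci.
  + unfold rlin; destruct a, b; simpl; ring.
  + intros; destruct x; simpl; ring.
- rewrite (key Im Ci (Im z0) (fun t => (Re z0, t))); auto using im_le_Cmod, Cmod_Ci.
  + unfold rlin; destruct a, b; simpl; ring.
  + intros; destruct x; simpl; ring.
Qed.

(** Identifies the coefficients delivered by the sum and product rules with the Wirtinger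
    derivatives that enter [lambda_]. *)
Lemma strict_diff_dz (g : C -> C) (z0 a b : C) :
  strict_diff g z0 a b -> dz g z0 = a /\ dzbar g z0 = b.
Proof.
intros H; destruct (strict_diff_Derive _ _ _ _ H) as (E1 & E2 & E3 & E4).
unfold dz, dzbar, dx, dy; rewrite E1, E2, E3, E4.
destruct a, b; split; apply injective_projections; simpl; field.
Qed.

Lemma strict_diff_lipschitz (g : C -> C) (z0 a b : C) :
  strict_diff g z0 a b -> exists d, 0 < d /\ forall z w,
    Cmod (z - z0) < d -> Cmod (w - z0) < d ->
    Cmod (g z - g w) <= (Cmod a + Cmod b + 1) * Cmod (z - w).
Proof.
intros H; destruct (H 1 Rlt_0_1) as (d & d0 & Hd).
exists d; split; auto; intros z w Hz Hw; specialize (Hd z w Hz Hw).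
assert (U := rlin_upper a b (z - w)).
replace (g z - g w)%C with (g z - g w - rlin a b (z - w) + rlin a b (z - w))%C by ring.
eapply Rle_trans; [apply Cmod_triangle|]; lra.
Qed.

Lemma strict_diff_ext (g h : C -> C) (z0 a b : C) :
  locally z0 (fun z => g z = h z) -> strict_diff g z0 a b -> strict_diff h z0 a b.
Proof.
intros E H eps e0; apply locally_CmodP in E.
destruct E as (d1 & d10 & E), (H eps e0) as (d2 & d20 & Hd).
exists (Rmin d1 d2); split; [apply Rmin_pos; auto|]; intros z w Hz Hw.
assert (M1 := Rmin_l d1 d2); assert (M2 := Rmin_r d1 d2).
rewrite <- !E by lra; apply Hd; lra.
Qed.

Lemma strict_diff_rlin (z0 a b : C) : strict_diff (rlin a b) z0 a b.
Proof.
intros eps e0; exists 1; split; [lra|]; intros z w _ _.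
replace (_ - _ - _)%C with (RtoC 0).
- rewrite Cmod_0; apply Rmult_le_pos; [lra|apply Cmod_ge_0].
- unfold rlin; rewrite Cminus_conj; ring.
Qed.

Lemma strict_diff_plus (g h : C -> C) (z0 a b a' b' : C) :
  strict_diff g z0 a b -> strict_diff h z0 a' b' ->
  strict_diff (fun z => g z + h z)%C z0 (a + a') (b + b').
Proof.
intros H1 H2 eps e0.
destruct (H1 (eps / 2)) as (d1 & d10 & I1); [lra|].
destruct (H2 (eps / 2)) as (d2 & d20 & I2); [lra|].
exists (Rmin d1 d2); split; [apply Rmin_pos; auto|]; intros z w Hz Hw.
assert (M1 := Rmin_l d1 d2); assert (M2 := Rmin_r d1 d2).
specialize (I1 z w ltac:(lra) ltac:(lra)).
specialize (I2 z w ltac:(lra) ltac:(lra)).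
replace (_ - _ - _)%C with
  ((g z - g w - rlin a b (z - w)) + (h z - h w - rlin a' b' (z - w)))%C
  by (unfold rlin; ring).
eapply Rle_trans; [apply Cmod_triangle|]; lra.
Qed.

Lemma strict_diff_mult (g h : C -> C) (z0 a b a' b' : C) :
  strict_diff g z0 a b -> strict_diff h z0 a' b' ->
  strict_diff (fun z => g z * h z)%C z0 (a * h z0 + g z0 * a') (b * h z0 + g z0 * b').
Proof.
intros H1 H2 eps e0.
destruct (strict_diff_lipschitz _ _ _ _ H1) as (d1 & d10 & L1).
destruct (strict_diff_lipschitz _ _ _ _ H2) as (d2 & d20 & L2).
set (l1 := Cmod a + Cmod b + 1) in *; set (l2 := Cmod a' + Cmod b' + 1) in *.
assert (l10 : 0 < l1) by (unfold l1; generalize (Cmod_ge_0 a) (Cmod_ge_0 b); lra).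
assert (l20 : 0 < l2) by (unfold l2; generalize (Cmod_ge_0 a') (Cmod_ge_0 b'); lra).
(* The summand 1 keeps [B] positive. The linear errors will use half of [eps], and each of the two
   products of increments a quarter. *)
set (B := Cmod (g z0) + Cmod (h z0) + 1).
assert (G0 := Cmod_ge_0 (g z0)); assert (H0 := Cmod_ge_0 (h z0)).
assert (e1 : 0 < eps / (2 * B)) by (apply Rdiv_lt_0_compat; unfold B; lra).
destruct (H1 _ e1) as (d3 & d30 & I1).
destruct (H2 _ e1) as (d4 & d40 & I2).
assert (ll : 0 < l1 * l2) by (apply Rmult_lt_0_compat; auto).
assert (d50 : 0 < eps / (4 * (l1 * l2))) by (apply Rdiv_lt_0_compat; lra).
exists (Rmin (Rmin d1 d2) (Rmin (Rmin d3 d4) (eps / (4 * (l1 * l2))))).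
split; [repeat apply Rmin_pos; auto|]; intros z w Hz Hw.
apply Rmin_Rgt in Hz; destruct Hz as [Hz1 Hz2].
apply Rmin_Rgt in Hz1; apply Rmin_Rgt in Hz2; destruct Hz1, Hz2 as [Hz2 Hz5].
apply Rmin_Rgt in Hz2; destruct Hz2.
apply Rmin_Rgt in Hw; destruct Hw as [Hw1 Hw2].
apply Rmin_Rgt in Hw1; apply Rmin_Rgt in Hw2; destruct Hw1, Hw2 as [Hw2 Hw5].
apply Rmin_Rgt in Hw2; destruct Hw2.
assert (Z : Cmod (z0 - z0) = 0).
{ replace (z0 - z0)%C with (RtoC 0) by ring; apply Cmod_0. }
specialize (I1 z w ltac:(lra) ltac:(lra)).
specialize (I2 z w ltac:(lra) ltac:(lra)).
assert (J1 := L1 z w ltac:(lra) ltac:(lra)).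
assert (J2 := L2 z w ltac:(lra) ltac:(lra)).
assert (J3 := L1 w z0 ltac:(lra) ltac:(lra)).
assert (J4 := L2 z z0 ltac:(lra) ltac:(lra)).
assert (N := Cmod_ge_0 (z - w)); set (n := Cmod (z - w)) in *.
replace (_ - _ - _)%C with
  ((g z - g w - rlin a b (z - w)) * h z0 + g z0 * (h z - h w - rlin a' b' (z - w))
   + ((g z - g w) * (h z - h z0) + (g w - g z0) * (h z - h w)))%C
  by (unfold rlin; ring).
replace (eps * n) with
  (eps / (2 * B) * n * B
   + (l1 * n * (l2 * (eps / (4 * (l1 * l2)))) + l1 * (eps / (4 * (l1 * l2))) * (l2 * n)))
  by (field; repeat split; unfold B; lra).
eapply Rle_trans; [apply Cmod_triangle|]; apply Rplus_le_compat;
  (eapply Rle_trans; [apply Cmod_triangle|]); rewrite !Cmod_mult.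
- apply Rle_trans with (eps / (2 * B) * n * Cmod (h z0) + Cmod (g z0) * (eps / (2 * B) * n)).
  + apply Rplus_le_compat; [apply Rmult_le_compat_r|apply Rmult_le_compat_l]; auto.
  + replace (_ + _) with (eps / (2 * B) * n * (B - 1)) by (unfold B; ring).
    apply Rmult_le_compat_l; [apply Rmult_le_pos|]; lra.
- apply Rplus_le_compat; apply Rmult_le_compat; auto using Cmod_ge_0;
    (eapply Rle_trans; [eassumption|]; apply Rmult_le_compat_l; lra).
Qed.

(** Since $|z|^{2m}=z^m\overline z^m$, both Wirtinger derivatives have modulus $m|z|^{2m-1}$ for
    $m\ge 1$, which is at most $m$ in the disk. With $m=p-1$, the two of them account for the term
    $2(p-1)|G|$. The induction multiplies by $z\overline z$. *)
Lemma strict_diff_Cmod_pow (m : nat) (z0 : C) : Cmod z0 < 1 -> exists a b,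
  strict_diff (fun z => RtoC (Cmod z ^ (2 * m))) z0 a b /\
  Cmod a <= INR m /\ Cmod b <= INR m.
Proof.
intros Hz; induction m as [|m (a & b & Hs & Ha & Hb)].
- exists (RtoC 0), (RtoC 0); rewrite Cmod_0; repeat split; simpl; try lra.
  intros eps e0; exists 1; split; [lra|]; intros z w _ _.
  replace (_ - _ - _)%C with (RtoC 0) by (unfold rlin; ring).
  rewrite Cmod_0; apply Rmult_le_pos; [lra|apply Cmod_ge_0].
- assert (H2 := strict_diff_mult _ _ _ _ _ _ _ (strict_diff_rlin z0 1 0) (strict_diff_rlin z0 0 1)).
  assert (H3 := strict_diff_mult _ _ _ _ _ _ _ Hs H2); cbv beta in H3.
  eexists _, _; split; [refine (strict_diff_ext _ _ _ _ _ _ H3)|].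
  { apply filter_forall; intros z.
    replace (2 * S m)%nat with (2 * m + 2)%nat by lia.
    rewrite pow_add, RtoC_mult, Cmod2_conj; unfold rlin; ring. }
  assert (P0 := Cmod_ge_0 z0).
  assert (P1 : 0 <= Cmod z0 ^ (2 * m) <= 1).
  { split; [apply pow_le; auto|].
    rewrite <- (pow1 (2 * m)); apply pow_incr; lra. }
  unfold rlin.
  replace ((1 * z0 + 0 * Cconj z0) * (0 * z0 + 1 * Cconj z0))%C with (z0 * Cconj z0)%C by ring.
  replace ((1 * (0 * z0 + 1 * Cconj z0) + (1 * z0 + 0 * Cconj z0) * 0))%C with (Cconj z0) by ring.
  replace ((0 * (0 * z0 + 1 * Cconj z0) + (1 * z0 + 0 * Cconj z0) * 1))%C with z0 by ring.
  rewrite S_INR; split; (eapply Rle_trans; [apply Cmod_triangle|]);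
    rewrite !Cmod_mult, ?Cmod_conj, Cmod_R, Rabs_pos_eq by apply P1;
    apply Rplus_le_compat.
  + rewrite <- (Rmult_1_r (INR m)); apply Rmult_le_compat; auto using Cmod_ge_0; nra.
  + nra.
  + rewrite <- (Rmult_1_r (INR m)); apply Rmult_le_compat; auto using Cmod_ge_0; nra.
  + nra.
Qed.

(** * Local surjectivity of maps with invertible derivative *)

(** Cramer's rule for the equation together with its conjugate; the determinant is $|a|^2-|b|^2$. *)
Lemma rlin_surjective (a b v : C) : Cmod a <> Cmod b -> exists h, rlin a b h = v.
Proof.
intros ab.
assert (D0 : (RtoC (Cmod a ^ 2) - RtoC (Cmod b ^ 2))%C <> 0%C).
{ rewrite <- RtoC_minus; intros E; apply RtoC_inj in E.
  generalize (Cmod_ge_0 a) (Cmod_ge_0 b); intros; apply ab; nra. }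
exists ((Cconj a * v - b * Cconj v) / (RtoC (Cmod a ^ 2) - RtoC (Cmod b ^ 2)))%C.
unfold rlin; rewrite Cdiv_conj, !Cminus_conj, !Cmult_conj, !Cconj_conj by auto.
assert (CR : forall x : R, Cconj (RtoC x) = RtoC x).
{ intros; apply injective_projections; simpl; ring. }
rewrite !CR; rewrite !Cmod2_conj in *; field; auto.
Qed.

Lemma geometric_Cauchy_limit (z : nat -> C) (c : R) :
  (forall n, Cmod (z (S n) - z n) <= c * (/ 2) ^ n) ->
  exists l, forall eps, 0 < eps -> exists N, forall n, (N <= n)%nat -> Cmod (z n - l) < eps.
Proof.
intros H.
destruct (@ex_series_le C_AbsRing C_CompleteNormedModule
  (fun n => (z (S n) - z n)%C) (fun n => c * (/ 2) ^ n)) as [l Hl].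
- exact H.
- apply (@ex_series_scal R_AbsRing R_NormedModule c (pow (/ 2))), ex_series_geom; rewrite Rabs_pos_eq; lra.
- exists (z 0%nat + l)%C; intros eps e0.
  (* The series telescopes; its partial sum of index [n] ends at [z (S n)], whence the shift to
     [S N] below. *)
  assert (E : forall n, sum_n (fun n => (z (S n) - z n)%C) n = (z (S n) - z 0%nat)%C).
  { induction n as [|n IH]; [apply sum_O|].
    rewrite sum_Sn, IH; unfold plus; simpl; ring. }
  destruct (Hl (fun w => Cmod (w - l) < eps)) as [N HN].
  { apply locally_CmodP; exists eps; auto. }
  exists (S N); intros [|n] Hn; [lia|].
  specialize (HN n ltac:(lia)); cbv beta in HN; rewrite E in HN.
  replace (z (S n) - _)%C with (z (S n) - z 0%nat - l)%C by ring; exact HN.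
Qed.

(* Simplified Newton iteration [z' = z + A^-1 (y - f z)] with the fixed
   derivative [A] of [f] at [z0]; the residual is halved at each step. *)
Lemma strict_diff_open (f : C -> C) (z0 a b : C) (r : R) :
  strict_diff f z0 a b -> Cmod a <> Cmod b -> 0 < r ->
  exists rho, 0 < rho /\ forall y, Cmod (y - f z0) < rho ->
    exists z, Cmod (z - z0) < r /\ f z = y.
Proof.
intros Hf ab r0.
set (l := Rabs (Cmod a - Cmod b)).
assert (l0 : 0 < l) by (apply Rabs_pos_lt; lra).
destruct (Hf (l / 2)) as (d1 & d10 & I1); [lra|].
destruct (strict_diff_lipschitz _ _ _ _ Hf) as (d2 & d20 & I2).
set (d := Rmin r (Rmin d1 d2)).
assert (d0 : 0 < d) by (repeat apply Rmin_pos; auto).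
assert (dr : d <= r) by apply Rmin_l.
assert (dd1 : d <= d1) by (eapply Rle_trans; [apply Rmin_r|apply Rmin_l]).
assert (dd2 : d <= d2) by (eapply Rle_trans; [apply Rmin_r|apply Rmin_r]).
(* With this initial residual the successive steps are at most $d/4, d/8, \dots$, so all iterates
   stay within $d/2$ of [z0]. *)
exists (l * d / 4); split; [nra|]; intros y Hy.
(* A preimage chosen for each vector; it enters only through [invP] and the bound [invB]. *)
set (inv v := proj1_sig (constructive_indefinite_description _ (rlin_surjective a b v ab))).
assert (invP : forall v, rlin a b (inv v) = v).
{ intros v; apply (proj2_sig (constructive_indefinite_description _ (rlin_surjective a b v ab))). }
assert (invB : forall v, l * Cmod (inv v) <= Cmod v).
{ intros v; rewrite <- (invP v) at 2; apply rlin_lower. }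
clearbody inv.
set (z := fix z n := match n with O => z0 | S m => (z m + inv (y - f (z m)))%C end).
assert (Z : Cmod (z0 - z0) = 0).
{ replace (z0 - z0)%C with (RtoC 0) by ring; apply Cmod_0. }
assert (Inv : forall n, Cmod (y - f (z n)) <= l * d / 4 * (/ 2) ^ n /\
                   Cmod (z n - z0) <= d / 2 * (1 - (/ 2) ^ n)).
{ induction n as [|n [IH1 IH2]].
  - simpl; rewrite Z; lra.
  - assert (p0 : 0 < (/ 2) ^ n) by (apply pow_lt; lra).
    set (p := (/ 2) ^ n) in *.
    assert (St : Cmod (z (S n) - z n) <= d / 4 * p).
    { replace (z (S n) - z n)%C with (inv (y - f (z n))%C) by (simpl; ring).
      apply Rmult_le_reg_l with l; auto.
      eapply Rle_trans; [apply invB|]; lra. }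
    assert (S2 : Cmod (z (S n) - z0) <= d / 2 * (1 - / 2 * p)).
    { generalize (Cmod_minus_triangle (z (S n)) (z n) z0); lra. }
    split; [|exact S2].
    change ((/ 2) ^ S n) with (/ 2 * p).
    (* The Newton step cancels the residual to first order. What remains is at most [l / 2] times
       the step length [d / 4 * p], that is, half of the old bound [l * d / 4 * p]. *)
    assert (Q := I1 (z (S n)) (z n) ltac:(nra) ltac:(nra)).
    replace (rlin a b _) with (y - f (z n))%C in Q.
    + rewrite <- Cmod_opp.
      replace (- (y - f (z (S n))))%C with
        (f (z (S n)) - f (z n) - (y - f (z n)))%C by ring.
      eapply Rle_trans; [apply Q|]; nra.
    + rewrite <- (invP (y - f (z n))%C) at 1; f_equal; simpl; ring. }
destruct (geometric_Cauchy_limit z (d / 4)) as [x Hx].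
{ intros n; destruct (Inv n) as [H1 _].
  replace (z (S n) - z n)%C with (inv (y - f (z n))%C) by (simpl; ring).
  apply Rmult_le_reg_l with l; auto.
  eapply Rle_trans; [apply invB|]; lra. }
assert (xr : Cmod (x - z0) < d).
{ destruct (Hx (d / 2)) as [N HN]; [lra|].
  specialize (HN N ltac:(lia)); rewrite Cmod_minus_sym in HN.
  assert (p0 : 0 < (/ 2) ^ N) by (apply pow_lt; lra).
  destruct (Inv N) as [_ H2].
  generalize (Cmod_minus_triangle x (z N) z0); nra. }
exists x; split; [lra|].
(* The residual at the limit: that of the n-th iterate tends to 0, and the Lipschitz bound controls
   the change of [f] from the iterate to [x]. *)
assert (E : Cmod (y - f x) = 0).
{ apply Rle_antisym; [|apply Cmod_ge_0]; apply le_epsilon; intros eps e0.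
  set (k := Cmod a + Cmod b + 1) in *.
  assert (k0 : 0 < k) by (unfold k; generalize (Cmod_ge_0 a) (Cmod_ge_0 b); lra).
  destruct (Hx (eps / (2 * k))) as [N HN]; [apply Rdiv_lt_0_compat; lra|].
  destruct (pow_lt_1_zero (/ 2)) with (y := eps / (l * d)) as [N' HN'].
  { rewrite Rabs_pos_eq; lra. }
  { apply Rdiv_lt_0_compat; nra. }
  set (n := max N N').
  specialize (HN n ltac:(lia)); specialize (HN' n ltac:(lia)).
  assert (p0 : 0 < (/ 2) ^ n) by (apply pow_lt; lra).
  rewrite Rabs_pos_eq in HN' by lra.
  destruct (Inv n) as [H1 H2].
  assert (Q := I2 (z n) x ltac:(nra) ltac:(lra)).
  assert (T := Cmod_minus_triangle y (f (z n)) (f x)).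
  assert (k * Cmod (z n - x) <= eps / 2).
  { replace (eps / 2) with (k * (eps / (2 * k))) by (field; lra).
    apply Rmult_le_compat_l; lra. }
  assert (l * d / 4 * (/ 2) ^ n <= eps / 4).
  { replace (eps / 4) with (l * d / 4 * (eps / (l * d))) by (field; lra).
    apply Rmult_le_compat_l; nra. }
  lra. }
apply Cmod_eq_0 in E.
replace (f x) with (y - (y - f x))%C by ring; rewrite E; ring.
Qed.

(** * Comparison of the increments of two maps *)

(** Near [z0] the increment of [f] is at least $(l-e)|z-w|$ and that of [h] at most $(n+e)|z-w|$,
    with $l=||a|-|b||$ and $n=|a'|+|b'|$. Because $n<kl$, small [e] and [d] give
    $n+e\le(k-d)(l-e)$. *)
Lemma strict_diff_quotient (f h : C -> C) (z0 a b a' b' : C) (k : R) :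
  strict_diff f z0 a b -> strict_diff h z0 a' b' -> Cmod a <> Cmod b ->
  (Cmod a' + Cmod b') / Rabs (Cmod a - Cmod b) < k ->
  exists d, 0 < d /\ forall z w, Cmod (z - z0) < d -> Cmod (w - z0) < d ->
    Cmod (h z - h w) <= (k - d) * Cmod (f z - f w).
Proof.
intros Hf Hh ab Hk.
set (l := Rabs (Cmod a - Cmod b)) in *.
assert (l0 : 0 < l) by (apply Rabs_pos_lt; lra).
assert (n0 : 0 <= Cmod a' + Cmod b').
{ generalize (Cmod_ge_0 a') (Cmod_ge_0 b'); lra. }
set (n := Cmod a' + Cmod b') in *.
assert (g0 : n < k * l) by (apply Rlt_div_l in Hk; auto).
assert (k0 : 0 < k) by nra.
(* The gap $kl-n$ is shared: half of it absorbs $e(1+k)$ and the other half, through [d3] below,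
   absorbs $dl$. The bound [l / 2] keeps $l-e$ positive. *)
set (e := Rmin (l / 2) ((k * l - n) / (2 * (1 + k)))).
assert (e0 : 0 < e) by (apply Rmin_pos; [|apply Rdiv_lt_0_compat]; lra).
assert (el : e <= l / 2) by apply Rmin_l.
assert (ek : e * (1 + k) <= (k * l - n) / 2).
{ replace (_ / 2) with ((k * l - n) / (2 * (1 + k)) * (1 + k)) by (field; lra).
  apply Rmult_le_compat_r; [lra|apply Rmin_r]. }
destruct (Hf e e0) as (d1 & d10 & I1), (Hh e e0) as (d2 & d20 & I2).
set (d3 := Rmin k ((k * l - n) / (2 * l))).
assert (d30 : 0 < d3) by (apply Rmin_pos; [|apply Rdiv_lt_0_compat]; lra).
assert (dk : d3 <= k) by apply Rmin_l.
assert (dl : d3 * l <= (k * l - n) / 2).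
{ replace (_ / 2) with ((k * l - n) / (2 * l) * l) by (field; lra).
  apply Rmult_le_compat_r; [lra|apply Rmin_r]. }
assert (M1 := Rmin_l d1 (Rmin d2 d3)); assert (M2 := Rmin_r d1 (Rmin d2 d3)).
assert (M3 := Rmin_l d2 d3); assert (M4 := Rmin_r d2 d3).
assert (d0 : 0 < Rmin d1 (Rmin d2 d3)) by (apply Rmin_pos; [|apply Rmin_pos]; auto).
exists (Rmin d1 (Rmin d2 d3)); split; auto.
set (d := Rmin d1 (Rmin d2 d3)) in *; intros z w Hz Hw.
specialize (I1 z w ltac:(lra) ltac:(lra)).
specialize (I2 z w ltac:(lra) ltac:(lra)).
assert (L := rlin_lower a b (z - w)); assert (U := rlin_upper a' b' (z - w)).
fold l in L; fold n in U.
assert (N := Cmod_ge_0 (z - w)).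
assert (L1 : (l - e) * Cmod (z - w) <= Cmod (f z - f w)).
{ generalize (Cmod_triangle_inv (rlin a b (z - w)) (f z - f w - rlin a b (z - w))).
  replace (_ + _)%C with (f z - f w)%C by ring; lra. }
assert (U1 : Cmod (h z - h w) <= (n + e) * Cmod (z - w)).
{ generalize (Cmod_triangle (rlin a' b' (z - w)) (h z - h w - rlin a' b' (z - w))).
  replace (_ + _)%C with (h z - h w)%C by ring; lra. }
eapply Rle_trans; [apply U1|].
apply Rle_trans with ((k - d) * ((l - e) * Cmod (z - w))).
- rewrite <- Rmult_assoc; apply Rmult_le_compat_r; auto.
  assert (d <= d3) by lra.
  assert (d * l <= d3 * l) by (apply Rmult_le_compat_r; lra).
  assert (0 <= d * e) by (apply Rmult_le_pos; lra).
  lra.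
- apply Rmult_le_compat_l; lra.
Qed.

(** * Path length, connectedness and open images *)

Lemma path_length_le (gamma : R -> C) (L : R) :
  Rbar_le (path_length gamma) L <-> forall l, inscribed_length gamma l -> l <= L.
Proof.
destruct (Lub_Rbar_correct (inscribed_length gamma)) as [ub lub]; split; intros H.
- intros l Hl; apply (Rbar_le_trans l (path_length gamma) L); auto; apply ub; auto.
- apply lub; intros l Hl; apply H; auto.
Qed.

Lemma continuous_on_unit_interval (gamma : R -> C) (t : R) (P : C -> Prop) :
  continuous_on unit_interval gamma -> unit_interval t -> locally (gamma t) P ->
  exists d, 0 < d /\ forall s, unit_interval s -> Rabs (s - t) < d -> P (gamma s).
Proof.
intros H Ht HP; destruct (H t Ht P HP) as [d Hd].
exists d; split; [apply cond_pos|]; intros s Hs Hst; apply Hd; auto.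
Qed.

(** The chord between the endpoints is an inscribed polygon, hence no longer than the path. This
    makes [M] positive and [1 / M] meaningful. *)
Lemma linearly_connected_with_ge1 (M : R) (W : C -> Prop) (w1 w2 : C) :
  linearly_connected_with M W -> W w1 -> W w2 -> w1 <> w2 -> 1 <= M.
Proof.
intros H W1 W2 N; destruct (H w1 w2 W1 W2) as (gamma & (_ & E0 & E1 & _) & L).
apply (proj1 (path_length_le gamma _)) with (l := Cmod (w2 - w1)) in L.
- assert (P : 0 < Cmod (w1 - w2)).
  { apply Cmod_gt_0; intros E; apply N.
    replace w1 with (w1 - w2 + w2)%C by ring; rewrite E; ring. }
  rewrite Cmod_minus_sym in L; nra.
(* The subdivision 0, 1 with a single chord. *)
- exists 0%nat, INR; repeat split; auto.
  + intros; apply le_INR; lia.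
  + rewrite sum_O; simpl; rewrite E0, E1; auto.
Qed.

(** If [U] and [V] separated [W], the indicator of [U] along a path from [w1] to [w2] would be
    continuous with values 0 and 1 only, against the intermediate value theorem. *)
Lemma path_connected_set (W : C -> Prop) :
  (forall w1 w2, W w1 -> W w2 -> exists gamma, path_in W gamma w1 w2) -> connected_set W.
Proof.
intros H U V oU oV cov [w1 [W1 U1]] [w2 [W2 V2]].
destruct (H w1 w2 W1 W2) as (gamma & cg & E0 & E1 & Wg).
apply NNPP; intros no.
(* Extends the path by constants to the whole line, where the intermediate value theorem asks for
   continuity. *)
set (clamp := fun t => Rmax 0 (Rmin 1 t)).
assert (clI : forall t, unit_interval (clamp t)).
{ intros t; unfold unit_interval, clamp, Rmax, Rmin; repeat destruct Rle_dec; lra. }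
assert (clL : forall s t, Rabs (clamp s - clamp t) <= Rabs (s - t)).
{ intros s t; unfold clamp, Rmax, Rmin, Rabs;
  repeat destruct Rle_dec; repeat destruct Rcase_abs; lra. }
assert (nhd : forall t (O : C -> Prop), open O -> O (gamma (clamp t)) ->
  locally t (fun s => O (gamma (clamp s)))).
{ intros t O oO Ot.
  destruct (continuous_on_unit_interval gamma (clamp t) O) as (d & d0 & Hd); auto.
  exists (mkposreal d d0); intros s Hs; apply Hd; auto.
  eapply Rle_lt_trans; [apply clL|apply Hs]. }
set (phi := fun t => if excluded_middle_informative (U (gamma (clamp t))) then 1 else 0).
destruct (IVT_gen_consistent phi 0 1 (/ 2)) as [x [_ Ex]].
- intros t; apply continuous_ext_loc with (fun _ => phi t); [|apply continuous_const].
  unfold phi; destruct excluded_middle_informative as [Ut|Ut].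
  + generalize (nhd t U oU Ut); apply filter_imp; intros s Us.
    destruct excluded_middle_informative; tauto.
  + destruct (cov (gamma (clamp t))) as [Ut'|Vt]; [apply Wg, clI|tauto|].
    generalize (nhd t V oV Vt); apply filter_imp; intros s Vs.
    destruct excluded_middle_informative as [Us|]; auto.
    exfalso; apply no; exists (gamma (clamp s)); auto.
- assert (C0 : clamp 0 = 0) by (unfold clamp, Rmax, Rmin; repeat destruct Rle_dec; lra).
  assert (C1 : clamp 1 = 1) by (unfold clamp, Rmax, Rmin; repeat destruct Rle_dec; lra).
  unfold phi; rewrite C0, C1, E0, E1.
  destruct excluded_middle_informative as [_|]; [|tauto].
  destruct excluded_middle_informative as [U2|_].
  + exfalso; apply no; exists w2; auto.
  + rewrite Rmin_right, Rmax_left; lra.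
- unfold phi in Ex; destruct excluded_middle_informative; lra.
Qed.

(* [d] is both the radius and the slack below [k], so that a Lebesgue number
   bounded by the radii along a compact path gives a uniform slack. *)
Definition locally_quotient_lt (D : C -> Prop) (f h : C -> C) (k : R) : Prop :=
  forall z0, D z0 -> exists d, 0 < d /\
    forall z w, Cmod (z - z0) < d -> Cmod (w - z0) < d ->
      Cmod (h z - h w) <= (k - d) * Cmod (f z - f w).

Definition locally_onto (D : C -> Prop) (f : C -> C) : Prop :=
  forall z0 r, D z0 -> 0 < r -> exists rho, 0 < rho /\
    forall y, Cmod (y - f z0) < rho -> exists z, Cmod (z - z0) < r /\ f z = y.

Lemma locally_onto_open_image (D : C -> Prop) (f : C -> C) :
  open D -> locally_onto D f -> open (image f D).
Proof.
intros oD of w [z [Dz ->]].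
destruct (proj1 (locally_CmodP D z) (oD z Dz)) as (r & r0 & Hr).
destruct (of z r Dz r0) as (rho & rho0 & Hrho).
apply locally_CmodP; exists rho; split; auto; intros y Hy.
destruct (Hrho y Hy) as (x & Hx & <-); exists x; auto.
Qed.

(** * From local estimates to global ones along paths *)

(** Subdivide the path so finely that consecutive points fall under a common local estimate, and add
    up: the increment of [h] is at most [k - d] times the length of an inscribed polygon. The
    uniform slack [d] yields the strict inequality. *)
Lemma quotient_estimate_along_path (D : C -> Prop) (f h : C -> C) (k L : R)
    (gamma : R -> C) (z1 z2 : C) :
  open D -> univalent_on D f -> locally_onto D f -> locally_quotient_lt D f h k ->
  0 < k -> 0 < L -> D z1 -> D z2 ->
  path_in (image f D) gamma (f z1) (f z2) ->
  (forall l, inscribed_length gamma l -> l <= L) ->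
  Cmod (h z2 - h z1) < k * L.
Proof.
intros oD uf of qf k0 L0 D1 D2 (cg & E0 & E1 & Wg) HL.
(* The estimate holds on radius [2 * d], so that it covers all points within [d] of any [s] that is
   itself within [d] of [t]. Outside the interval any radius serves. *)
assert (loc : forall t, exists d : posreal, unit_interval t ->
  forall s s', unit_interval s -> unit_interval s' ->
    Rabs (s - t) < 2 * d -> Rabs (s' - t) < 2 * d ->
  forall z z', D z -> D z' -> f z = gamma s -> f z' = gamma s' ->
    Cmod (h z - h z') <= (k - d) * Cmod (gamma s - gamma s')).
{ intros t; destruct (classic (unit_interval t)) as [It|It];
    [|exists (mkposreal 1 Rlt_0_1); tauto].
  destruct (Wg t It) as (z0 & Dz0 & Ez0).
  destruct (qf z0 Dz0) as (d1 & d10 & I1).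
  destruct (proj1 (locally_CmodP D z0) (oD z0 Dz0)) as (r & r0 & Hr).
  destruct (of z0 (Rmin d1 r) Dz0 (Rmin_pos _ _ d10 r0)) as (rho & rho0 & Hrho).
  destruct (continuous_on_unit_interval gamma t (fun w => Cmod (w - f z0) < rho))
    as (d2 & d20 & I2); auto.
  { rewrite Ez0; apply locally_CmodP; exists rho; auto. }
  assert (d30 : 0 < Rmin d1 (d2 / 2)) by (apply Rmin_pos; lra).
  exists (mkposreal _ d30); simpl; intros _ s s' Is Is' Hs Hs' z z' Dz Dz' Ez Ez'.
  assert (M1 := Rmin_l d1 (d2 / 2)); assert (M2 := Rmin_r d1 (d2 / 2)).
  assert (M3 := Rmin_l d1 r); assert (M4 := Rmin_r d1 r).
  (* Continuity of the inverse of [f]: local surjectivity yields a preimage close to [z0], and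
     univalence identifies it with the given one. *)
  assert (near : forall s z, unit_interval s -> Rabs (s - t) < d2 -> D z -> f z = gamma s ->
            Cmod (z - z0) < d1).
  { intros u x Iu Hu Dx Ex; destruct (Hrho _ (I2 u Iu Hu)) as (y & Hy & Ey).
    rewrite (uf x y); [lra|auto|apply Hr; lra|congruence]. }
  rewrite <- Ez, <- Ez'; eapply Rle_trans; [apply I1|].
  - apply (near s); auto; lra.
  - apply (near s'); auto; lra.
  - apply Rmult_le_compat_r; [apply Cmod_ge_0|lra]. }
set (delta t := proj1_sig (constructive_indefinite_description _ (loc t))).
assert (Hdelta := fun t => proj2_sig (constructive_indefinite_description _ (loc t))).
cbv beta in Hdelta; fold delta in Hdelta.
(* A Lebesgue number of the cover: every [s] is within [delta t] of some [t] with [d <= delta t], so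
   [d] is both a uniform mesh bound and a uniform slack. *)
destruct (compactness_value_1d 0 1 delta) as [d Hd].
assert (unif : forall s s' z z', unit_interval s -> unit_interval s' -> Rabs (s' - s) < d ->
   D z -> D z' -> f z = gamma s -> f z' = gamma s' ->
   Cmod (h z' - h z) <= (k - d) * Cmod (gamma s' - gamma s)).
{ intros s s' z z' Is Is' Hs Dz Dz' Ez Ez'.
  destruct (NNPP _ (Hd s Is)) as (t & It & Ht & dt).
  eapply Rle_trans; [apply (Hdelta t It s' s); auto|].
  - fold (delta t).
    generalize (Rabs_triang (s' - s) (s - t)); replace (s' - s + (s - t)) with (s' - t) by ring; lra.
  - fold (delta t); generalize (cond_pos (delta t)); lra.
  - fold (delta t); apply Rmult_le_compat_r; [apply Cmod_ge_0|lra]. }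
destruct (archimed_cor1 d (cond_pos d)) as (N & HN & N0).
destruct N as [|n]; [lia|].
set (t := fun i => INR i / INR (S n)).
assert (S0 : 0 < INR (S n)) by (apply lt_0_INR; lia).
assert (It : forall i, (i <= S n)%nat -> unit_interval (t i)).
{ intros i Hi; split; unfold t.
  - apply Rdiv_le_0_compat; auto; apply pos_INR.
  - apply Rle_div_l; auto; rewrite Rmult_1_l; apply le_INR; auto. }
assert (Et : forall i, t (S i) - t i = / INR (S n)).
{ intros i; unfold t; rewrite (S_INR i); field; lra. }
assert (t0 : t 0%nat = 0) by (unfold t; simpl INR; unfold Rdiv; ring).
assert (t1 : t (S n) = 1) by (unfold t; field; lra).
set (len := sum_n (fun i : nat => Cmod (gamma (t (S i)) - gamma (t i))%C)).
assert (step : forall i, (i <= n)%nat -> forall z, D z -> f z = gamma (t (S i)) ->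
  Cmod (h z - h z1) <= (k - d) * len i).
{ assert (near : forall i, Rabs (t (S i) - t i) < d).
  { intros i; rewrite Et, Rabs_pos_eq; auto; apply Rlt_le, Rinv_0_lt_compat; auto. }
  induction i as [|i IH]; intros Hi z Dz Ez; unfold len.
  - rewrite sum_O; apply unif; auto; [apply It; lia..|].
    rewrite t0; auto.
  - rewrite sum_Sn; fold len.
    destruct (Wg (t (S i))) as (x & Dx & Ex); [apply It; lia|].
    specialize (IH ltac:(lia) x Dx (eq_sym Ex)).
    assert (Q := unif _ _ x z (It (S i) ltac:(lia)) (It (S (S i)) ltac:(lia)) (near _) Dx Dz
                  (eq_sym Ex) Ez).
    generalize (Cmod_minus_triangle (h z) (h x) (h z1)); unfold plus; simpl plus; simpl; lra. }
assert (B : Cmod (h z2 - h z1) <= (k - d) * len n).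
{ apply step; auto; rewrite t1; auto. }
assert (lenL : len n <= L).
{ apply HL; exists n, t; repeat split; auto.
  intros i Hi; generalize (Et i) (Rinv_0_lt_compat _ S0); lra. }
assert (len0 : 0 <= len n).
{ unfold len; clearbody t; clear; induction n as [|n IH].
  - rewrite sum_O; apply Cmod_ge_0.
  - rewrite sum_Sn; apply Rplus_le_le_0_compat; auto; apply Cmod_ge_0. }
assert (d0 := cond_pos d).
assert (kl : k * len n <= k * L) by (apply Rmult_le_compat_l; lra).
(* Strictness comes from the slack when the polygon has positive length, and from [0 < k * L] when
   it is degenerate. *)
destruct len0 as [len0|E].
- generalize (Rmult_lt_0_compat _ _ d0 len0); lra.
- rewrite <- E in B; generalize (Rmult_lt_0_compat _ _ k0 L0); lra.
Qed.

Lemma linearly_connected_quotient (D : C -> Prop) (f h : C -> C) (k M : R) (z1 z2 : C) :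
  open D -> univalent_on D f -> locally_onto D f -> locally_quotient_lt D f h k ->
  0 < k -> 0 < M -> linearly_connected_with M (image f D) ->
  D z1 -> D z2 -> f z1 <> f z2 ->
  Cmod (h z1 - h z2) < k * M * Cmod (f z1 - f z2).
Proof.
intros oD uf of qf k0 M0 lc D1 D2 N.
destruct (lc (f z1) (f z2)) as (gamma & pg & L); [exists z1; auto|exists z2; auto|].
rewrite path_length_le in L.
rewrite Cmod_minus_sym, Rmult_assoc.
apply (quotient_estimate_along_path D f h k _ gamma z1 z2); auto.
apply Rmult_lt_0_compat; auto.
apply Cmod_gt_0; intros E; apply N.
replace (f z1) with (f z1 - f z2 + f z2)%C by ring; rewrite E; ring.
Qed.

(** Transport a short path by $g\circ f^{-1}$: its length grows by a factor of at most [A], while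
    [B] bounds the distance of the old endpoints by that of the new ones. *)
Lemma linearly_connected_bilipschitz (D : C -> Prop) (f g : C -> C) (M A B : R) :
  univalent_on D f -> linearly_connected_with M (image f D) -> 0 <= M -> 0 < A ->
  (forall z w, D z -> D w -> Cmod (g z - g w) <= A * Cmod (f z - f w)) ->
  (forall z w, D z -> D w -> Cmod (f z - f w) <= B * Cmod (g z - g w)) ->
  linearly_connected_with (A * M * B) (image g D).
Proof.
intros uf lc M0 A0 HA HB w1 w2 [z1 [D1 ->]] [z2 [D2 ->]].
destruct (lc (f z1) (f z2)) as (gamma & (cg & E0 & E1 & Wg) & L);
  [exists z1; auto|exists z2; auto|].
rewrite path_length_le in L.
(* Preimages are chosen point by point, with [z1] as default outside the interval. Continuity of the
   transported path will come from [lip]. *)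
assert (lift : forall t, exists z, unit_interval t -> D z /\ gamma t = f z).
{ intros t; destruct (classic (unit_interval t)) as [It|It]; [|exists z1; tauto].
  destruct (Wg t It) as [z Hz]; exists z; auto. }
set (zeta t := proj1_sig (constructive_indefinite_description _ (lift t))).
assert (Hz : forall t, unit_interval t -> D (zeta t) /\ gamma t = f (zeta t)).
{ intros t; exact (proj2_sig (constructive_indefinite_description _ (lift t))). }
clearbody zeta.
assert (I0 : unit_interval 0) by (split; lra).
assert (I1 : unit_interval 1) by (split; lra).
assert (lip : forall s t, unit_interval s -> unit_interval t ->
   Cmod (g (zeta s) - g (zeta t)) <= A * Cmod (gamma s - gamma t)).
{ intros s t Is It; destruct (Hz s Is) as [Ds ->], (Hz t It) as [Dt ->]; auto. }
exists (fun t => g (zeta t)); split; [repeat split|].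
- intros t It P HP; apply locally_CmodP in HP; destruct HP as (e & e0 & He).
  destruct (continuous_on_unit_interval gamma t (fun w => Cmod (w - gamma t) < e / A))
    as (d & d0 & Hd); auto.
  { apply locally_CmodP; exists (e / A); split; auto; apply Rdiv_lt_0_compat; auto. }
  exists (mkposreal d d0); intros s Hs Is; apply He.
  eapply Rle_lt_trans; [apply lip; auto|].
  replace e with (A * (e / A)) by (field; lra).
  apply Rmult_lt_compat_l; auto.
- f_equal; apply uf; auto; [apply Hz; auto|].
  destruct (Hz 0 I0) as [_ E]; congruence.
- f_equal; apply uf; auto; [apply Hz; auto|].
  destruct (Hz 1 I1) as [_ E]; congruence.
- intros t It; exists (zeta t); split; auto; apply Hz; auto.
- apply path_length_le; intros l (n & t & T0 & T1 & mono & ->).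
  assert (It : forall i, (i <= S n)%nat -> unit_interval (t i)).
  (* A monotone subdivision stays in the interval: [up] inducts from its left end, [down] from its
     right end. *)
  { assert (up : forall i, (i <= S n)%nat -> 0 <= t i).
    { induction i as [|i IH]; intros Hi; [lra|].
      specialize (IH ltac:(lia)); specialize (mono i ltac:(lia)); lra. }
    assert (down : forall i, (i <= S n)%nat -> t (S n - i)%nat <= 1).
    { induction i as [|i IH]; intros Hi; [rewrite Nat.sub_0_r; lra|].
      specialize (IH ltac:(lia)); specialize (mono (S n - S i)%nat ltac:(lia)).
      replace (S (S n - S i)) with (S n - i)%nat in mono by lia; lra. }
    intros i Hi; split; auto.
    replace i with (S n - (S n - i))%nat by lia; apply down; lia. }
  apply Rle_trans with (A * sum_n (fun i => Cmod (gamma (t (S i)) - gamma (t i))%C) n).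
  + assert (S : forall m, (m <= n)%nat ->
      sum_n (fun i => Cmod (g (zeta (t (S i))) - g (zeta (t i)))%C) m <=
      A * sum_n (fun i => Cmod (gamma (t (S i)) - gamma (t i))%C) m).
    { induction m as [|m IH]; intros Hm.
      - rewrite !sum_O; apply lip; apply It; lia.
      - rewrite !sum_Sn; unfold plus; simpl; rewrite Rmult_plus_distr_l.
        apply Rplus_le_compat; [apply IH; lia|apply lip; apply It; lia]. }
    apply S; auto.
  + rewrite !Rmult_assoc; apply Rmult_le_compat_l; [lra|].
    eapply Rle_trans; [apply L; exists n, t; auto|].
    apply Rmult_le_compat_l; auto.
Qed.

(** * The unit disk and the two conclusions *)

Lemma open_unit_disk : open unit_disk.
Proof.
intros z Hz; apply locally_CmodP; exists (1 - Cmod z); split.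
- unfold unit_disk in Hz; lra.
- intros w Hw; unfold unit_disk.
  generalize (Cmod_triangle (w - z) z); replace (w - z + z)%C with w by ring; lra.
Qed.

Theorem theorem4 (p : nat) (hp : (1 <= p)%nat) (G K f : C -> C) (M : R)
    (hG : C1_on unit_disk G)
    (hK : harmonic_on unit_disk K)
    (hf : forall z : C, unit_disk z ->
       f z = (RtoC (Cmod z ^ (2 * (p - 1)))%R * G z + K z)%C)
    (hf_univ : univalent_on unit_disk f)
    (hf_dom : is_domain (image f unit_disk))
    (hf_lin : linearly_connected_with M (image f unit_disk))
    (hlambda : forall z : C, unit_disk z -> lambda_ f z <> 0) :
  ((forall z : C, unit_disk z ->
      (2 * (INR p - 1) * Cmod (G z) + Lambda_ G z) / Rabs (lambda_ f z) < 1 / M) ->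
   univalent_on unit_disk K)
  /\
  (forall c : R,
      (forall z : C, unit_disk z ->
         (2 * (INR p - 1) * Cmod (G z) + Lambda_ G z) / Rabs (lambda_ f z) <= c) ->
      c < 1 / M ->
      is_domain (image K unit_disk) /\ linearly_connected (image K unit_disk)).
Proof.
destruct hK as [[hK _] _].
set (H := fun z => (RtoC (Cmod z ^ (2 * (p - 1))) * G z)%C).
assert (fHK : forall z w, unit_disk z -> unit_disk w ->
  (f z - f w = (H z - H w) + (K z - K w))%C).
{ intros z w Dz Dw; rewrite !hf by auto; unfold H; ring. }
assert (sd : forall z0, unit_disk z0 -> exists a b, strict_diff H z0 a b /\
  Cmod a + Cmod b <= 2 * (INR p - 1) * Cmod (G z0) + Lambda_ G z0 /\
  strict_diff f z0 (a + dz K z0) (b + dzbar K z0)).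
{ intros z0 Dz0.
  destruct (strict_diff_Cmod_pow (p - 1) z0 Dz0) as (aq & bq & sq & Ha & Hb).
  assert (sG := C1_strict_diff _ _ _ open_unit_disk Dz0 hG).
  assert (sK := C1_strict_diff _ _ _ open_unit_disk Dz0 hK).
  assert (sH := strict_diff_mult _ _ _ _ _ _ _ sq sG).
  eexists _, _; split; [exact sH|split].
  - rewrite minus_INR in Ha, Hb by auto; simpl INR in Ha, Hb.
    assert (G0 := Cmod_ge_0 (G z0)); assert (P0 := Cmod_ge_0 z0).
    assert (P1 : 0 <= Cmod z0 ^ (2 * (p - 1)) <= 1).
    { split; [apply pow_le; auto|].
      rewrite <- (pow1 (2 * (p - 1))); apply pow_incr; unfold unit_disk in Dz0; lra. }
    (* Applied to each of the two coefficients of the product rule for [H]; the sum of the bounds is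
       the numerator $2(p-1)|G|+\Lambda_G$. *)
    assert (E : forall x y, Cmod x <= INR p - 1 ->
      Cmod (x * G z0 + RtoC (Cmod z0 ^ (2 * (p - 1))) * y)
        <= (INR p - 1) * Cmod (G z0) + Cmod y).
    { intros x y Hx; eapply Rle_trans; [apply Cmod_triangle|].
      rewrite !Cmod_mult, Cmod_R, (Rabs_pos_eq _ (proj1 P1)).
      assert (Y0 := Cmod_ge_0 y); nra. }
    assert (E1 := E _ (dz G z0) Ha); assert (E2 := E _ (dzbar G z0) Hb).
    unfold Lambda_; lra.
  - refine (strict_diff_ext _ _ _ _ _ _ (strict_diff_plus _ _ _ _ _ _ _ sH sK)).
    generalize (open_unit_disk z0 Dz0); apply filter_imp.
    intros z Dz; rewrite hf; auto. }
assert (onto : locally_onto unit_disk f).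
{ intros z0 r Dz0 r0; destruct (sd z0 Dz0) as (a & b & _ & _ & sf).
  apply (strict_diff_open _ _ _ _ _ sf); auto.
  destruct (strict_diff_dz _ _ _ _ sf) as [E1 E2].
  rewrite <- E1, <- E2; generalize (hlambda z0 Dz0); unfold lambda_; lra. }
assert (quot : forall k, (forall z, unit_disk z ->
  (2 * (INR p - 1) * Cmod (G z) + Lambda_ G z) / Rabs (lambda_ f z) < k) ->
  locally_quotient_lt unit_disk f H k).
{ intros k Hk z0 Dz0; destruct (sd z0 Dz0) as (a & b & sH & HG & sf).
  destruct (strict_diff_dz _ _ _ _ sf) as [E1 E2].
  specialize (hlambda z0 Dz0); specialize (Hk z0 Dz0).
  unfold lambda_ in hlambda, Hk; rewrite E1, E2 in hlambda, Hk.
  apply (strict_diff_quotient _ _ _ _ _ _ _ _ sf sH); [lra|].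
  eapply Rle_lt_trans; [|exact Hk].
  apply Rmult_le_compat_r; auto.
  apply Rlt_le, Rinv_0_lt_compat, Rabs_pos_lt; auto. }
(* By univalence, 0 and 1/2 have distinct images, which forces [1 <= M]. *)
assert (D0 : unit_disk 0%C) by (unfold unit_disk; rewrite Cmod_0; lra).
assert (D2 : unit_disk (RtoC (/ 2))).
{ unfold unit_disk; rewrite Cmod_R, Rabs_pos_eq; lra. }
assert (M1 : 1 <= M).
{ apply (linearly_connected_with_ge1 M (image f unit_disk) (f 0%C) (f (RtoC (/ 2)))); auto.
  - exists 0%C; auto.
  - exists (RtoC (/ 2)); auto.
  - intros E; apply hf_univ in E; auto; apply RtoC_inj in E; lra. }
assert (est : forall k, 0 < k -> (forall z, unit_disk z ->
  (2 * (INR p - 1) * Cmod (G z) + Lambda_ G z) / Rabs (lambda_ f z) < k) ->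
  forall z w, unit_disk z -> unit_disk w -> f z <> f w ->
  Cmod (H z - H w) < k * M * Cmod (f z - f w)).
{ intros k k0 Hk z w Dz Dw N.
  apply (linearly_connected_quotient unit_disk); auto using open_unit_disk; lra. }
assert (iM : 0 < 1 / M) by (apply Rdiv_lt_0_compat; lra).
split.
- intros HM z w Dz Dw E; apply NNPP; intros N.
  (* If $K$ takes equal values at $z\ne w$, the increments of [f] and [H] coincide, while the
     estimate with $k=1/M$ makes the latter strictly smaller. *)
  assert (Q := est (1 / M) iM HM z w Dz Dw (fun F => N (hf_univ z w Dz Dw F))).
  rewrite fHK, E in Q by auto.
  replace (H z - H w + (K w - K w))%C with (H z - H w)%C in Q by ring.
  replace (1 / M * M) with 1 in Q by (field; lra); lra.
- intros c Hc cM.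
  (* The midpoint turns the bound by [c] into a strict one and still leaves $kM<1$. *)
  set (k := (c + 1 / M) / 2).
  assert (Hk : forall z, unit_disk z ->
    (2 * (INR p - 1) * Cmod (G z) + Lambda_ G z) / Rabs (lambda_ f z) < k).
  { intros z Dz; specialize (Hc z Dz); unfold k; lra. }
  assert (k0 : 0 < k).
  { eapply Rle_lt_trans; [|apply (Hk _ D0)].
    destruct (sd _ D0) as (a & b & _ & Hab & _).
    apply Rdiv_le_0_compat; [|apply Rabs_pos_lt; auto].
    generalize (Cmod_ge_0 a) (Cmod_ge_0 b); lra. }
  set (q := k * M).
  assert (q0 : 0 < q) by (apply Rmult_lt_0_compat; lra).
  assert (q1 : q < 1).
  { unfold q; replace 1 with (1 / M * M) by (field; lra).
    apply Rmult_lt_compat_r; unfold k; lra. }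
  assert (HB : forall z w, unit_disk z -> unit_disk w ->
    Cmod (H z - H w) <= q * Cmod (f z - f w)).
  (* The strict estimate presupposes distinct images; in the remaining case both sides vanish. *)
  { intros z w Dz Dw; destruct (classic (f z = f w)) as [E|N].
    - rewrite (hf_univ z w Dz Dw E); unfold Cminus; rewrite !Cplus_opp_r, Cmod_0; lra.
    - apply Rlt_le, est; auto. }
  assert (KU : forall z w, unit_disk z -> unit_disk w ->
    Cmod (K z - K w) <= (1 + q) * Cmod (f z - f w)).
  { intros z w Dz Dw; specialize (HB z w Dz Dw).
    generalize (Cmod_triangle (f z - f w) (- (H z - H w))); rewrite Cmod_opp.
    replace (_ + _)%C with (K z - K w)%C by (rewrite fHK by auto; ring); lra. }
  assert (KL : forall z w, unit_disk z -> unit_disk w ->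
    Cmod (f z - f w) <= / (1 - q) * Cmod (K z - K w)).
  { intros z w Dz Dw; specialize (HB z w Dz Dw).
    apply Rmult_le_reg_l with (1 - q); [lra|].
    rewrite <- Rmult_assoc, Rinv_r, Rmult_1_l by lra.
    generalize (Cmod_triangle (H z - H w) (K z - K w)); rewrite <- fHK by auto; lra. }
  assert (lcK : linearly_connected_with ((1 + q) * M * / (1 - q)) (image K unit_disk)).
  { apply (linearly_connected_bilipschitz _ f); auto; lra. }
  split; [|exists ((1 + q) * M * / (1 - q)); auto].
  split; [exists (K 0%C), 0%C; auto|split].
  + apply locally_onto_open_image; [apply open_unit_disk|].
    intros z0 r Dz0 r0.
    apply (strict_diff_open K z0 (dz K z0) (dzbar K z0)); auto.
    { apply (C1_strict_diff unit_disk); auto using open_unit_disk. }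
    (* The derivative of $K$ is invertible: if $|K_z|=|K_{\overline z}|$, then
       $|\lambda_f|\le|a|+|b|<k|\lambda_f|\le|\lambda_f|$, where $k\le 1$ follows from $kM<1$ and
       $M\ge 1$. *)
    intros E.
    destruct (sd z0 Dz0) as (a & b & _ & Hab & sf).
    destruct (strict_diff_dz _ _ _ _ sf) as [E1 E2].
    specialize (Hk z0 Dz0); specialize (hlambda z0 Dz0).
    apply Rabs_pos_lt in hlambda.
    apply (Rlt_div_l _ k _ hlambda) in Hk.
    assert (k1 : k <= 1) by (unfold q in *; nra).
    assert (F : Rabs (lambda_ f z0) <= Cmod a + Cmod b).
    { unfold lambda_; rewrite E1, E2.
      generalize (Cmod_triangle a (dz K z0)) (Cmod_triangle b (dzbar K z0)).
      generalize (Cmod_triangle_inv (dz K z0) a) (Cmod_triangle_inv (dzbar K z0) b).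
      rewrite (Cplus_comm (dz K z0)), (Cplus_comm (dzbar K z0)).
      unfold Rabs; destruct Rcase_abs; lra. }
    generalize (Rmult_le_compat_r _ _ _ (Rlt_le _ _ hlambda) k1); lra.
  + apply path_connected_set; intros w1 w2 W1 W2.
    destruct (lcK w1 w2 W1 W2) as (gamma & Hg & _); exists gamma; auto.
Qed.
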